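(* Let $\alpha_0,\dots,\alpha_6$ be complex parameters with $\alpha_0+\alpha_1+2\alpha_2+2\alpha_3+2\alpha_4+\alpha_5+\alpha_6=1$. There exist two Hamiltonians $H_1,H_2$, polynomial in $(q_1,p_1,q_2,p_2)$ with coefficients rational in $(t,s)$, such that the Hamiltonian system $$dq_i=\frac{\partial H_1}{\partial p_i}dt+\frac{\partial H_2}{\partial p_i}ds,\qquad dp_i=-\frac{\partial H_1}{\partial q_i}dt-\frac{\partial H_2}{\partial q_i}ds\qquad(i=1,2)$$ is transformed into a polynomial Hamiltonian system under each of the following birational and symplectic transformations $R_i:(q_1,p_1,q_2,p_2)\mapsto(x_i,y_i,z_i,w_i)$, $i=0,\dots,6$: $$\begin{aligned} R_0:&\ \left(-((q_1-t)p_1-\alpha_0)p_1,\tfrac1{p_1},q_2,p_2\right),\\ R_1:&\ \left(-((q_1-s)p_1-\alpha_1)p_1,\tfrac1{p_1},q_2,p_2\right),\\ R_2:&\ \left(\tfrac1{q_1},-(p_1q_1+\alpha_2)q_1,q_2,p_2\right),\\ R_3:&\ \left(-((q_1-q_2)p_1-\alpha_3)p_1,\tfrac1{p_1},q_2,p_2+p_1\right),\\ R_4:&\ \left(q_1,p_1,\tfrac1{q_2},-(p_2q_2+\alpha_4)q_2\right),\\ R_5:&\ \left(q_1,p_1,-((q_2-1)p_2-\alpha_5)p_2,\tfrac1{p_2}\right),\\ R_6:&\ \left(q_1,p_1,-(q_2p_2-\alpha_6)p_2,\tfrac1{p_2}\right). \end{aligned}$$ These Hamiltonians are given by $$\begin{aligned}H_1=&\,H_{VI}(q_1,p_1,t,s;\alpha_0,\alpha_1,\alpha_2,\alpha_3+2\alpha_4+\alpha_5,\alpha_3+\alpha_6)\\&+H_{VI}(q_2,p_2,t,s;\alpha_0+2\alpha_2+\alpha_3,\alpha_1+\alpha_3,\alpha_4,\alpha_5,\alpha_6)\\&+\frac{2(q_1-s)q_2\{(q_1-t)p_1+\alpha_2\}\{(q_2-1)p_2+\alpha_4\}}{(\alpha_0+\alpha_1+2\alpha_2+2\alpha_3+2\alpha_4+\alpha_5+\alpha_6)\,t(t-1)(t-s)},\end{aligned}$$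 and $H_2=\pi(H_1)$, where $\pi$ is the substitution exchanging $t\leftrightarrow s$ and $\alpha_0\leftrightarrow\alpha_1$.
   Context: The symbol $H_{VI}(q,p,t,\eta;\beta_0,\beta_1,\beta_2,\beta_3,\beta_4)$ (with $\beta_0+\beta_1+2\beta_2+\beta_3+\beta_4=1$) is defined by $$\begin{aligned}&t(t-1)(t-\eta)H_{VI}(q,p,t,\eta;\beta_0,\dots,\beta_4)\\&=q(q-1)(q-\eta)(q-t)p^2+\{\beta_1(t-\eta)q(q-1)+2\beta_2q(q-1)(q-\eta)+\beta_3(t-1)q(q-\eta)+\beta_4t(q-1)(q-\eta)\}p\\&\quad+\beta_2\{(\beta_1+\beta_2)(t-\eta)+\beta_2(q-1)+\beta_3(t-1)+t\beta_4\}q.\end{aligned}$$ Being transformed into a polynomial Hamiltonian system under $R_i$ means that, in the coordinates $(x_i,y_i,z_i,w_i)$, the system is again Hamiltonian with Hamiltonians polynomial in $(x_i,y_i,z_i,w_i)$. Concretely, $H_1$ and $H_2$ rewritten in the new coordinates are polynomial (coefficients rational in $t,s$), except that, because $R_0$ depends on $t$ and $R_1$ depends on $s$, for $R_0$ the polynomial requirement on the first Hamiltonian is that $H_1-p_1$ is polynomial in $(x_0,y_0,z_0,w_0)$, and for $R_1$ the requirement on the second Hamiltonian is that $H_2-p_1$ is polynomial in $(x_1,y_1,z_1,w_1)$. *)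

(* Defs.v *)
From HB Require Import structures.
From mathcomp Require Import all_boot all_order all_algebra.
From mathcomp Require Import generic_quotient fraction complex mpoly.
From mathcomp Require Import reals.

Set Implicit Arguments.
Unset Strict Implicit.
Unset Printing Implicit Defensive.

Import GRing.Theory.
Local Open Scope ring_scope.

(* Everything is done algebraically: C(t,s) is the field of coefficients,
   polynomials in (q1,p1,q2,p2) over it are {mpoly _[4]}, and rational
   functions of (q1,p1,q2,p2) are the fractions of these. *)
Notation Cts R := {fraction {mpoly (complex R)[2]}}.
Notation ratfun F := {fraction {mpoly F[4]}}.

(* Order of the phase-space variables: (q1, p1, q2, p2), resp. (x, y, z, w). *)
Definition iq1 : 'I_4 := @Ordinal 4 0 isT.
Definition ip1 : 'I_4 := @Ordinal 4 1 isT.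
Definition iq2 : 'I_4 := @Ordinal 4 2 isT.
Definition ip2 : 'I_4 := @Ordinal 4 3 isT.

(* Quotient rule; for a derivation D the value does not depend on the
   representative n / d of f. *)
Definition frac_deriv (A : idomainType) (D : A -> A) (f : {fraction A}) :
    {fraction A} :=
  let n := \n_(repr f) in
  let d := \d_(repr f) in
  (tofrac (D n) * tofrac d - tofrac n * tofrac (D d)) / tofrac d ^+ 2.

Section PhaseSpace.
Variable F : fieldType.
Implicit Types (xi eta : 'I_4 -> ratfun F) (p : {mpoly F[4]}) (f : ratfun F).

Definition cst (c : F) : ratfun F := tofrac (mpolyC 4 c).

Definition phase_var (a : 'I_4) : ratfun F := tofrac 'X_a.

Definition pderiv (a : 'I_4) : ratfun F -> ratfun F := frac_deriv (mderiv a).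

(* p(xi_0, xi_1, xi_2, xi_3) *)
Definition eval_at xi p : ratfun F := mmap cst xi p.

(* The composite f(xi_0, xi_1, xi_2, xi_3) is defined and equal to g. *)
Definition comp_eq f xi (g : ratfun F) : Prop :=
  exists n d : {mpoly F[4]},
    [/\ f = tofrac n / tofrac d, eval_at xi d != 0 &
        g = eval_at xi n / eval_at xi d].

Definition birational xi : Prop :=
  exists eta : 'I_4 -> ratfun F,
    (forall a, comp_eq (eta a) xi (phase_var a)) /\
    (forall a, comp_eq (xi a) eta (phase_var a)).

Definition jacobian xi : 'M[ratfun F]_4 := \matrix_(a, b) pderiv b (xi a).

(* Matrix of the 2-form dq1 /\ dp1 + dq2 /\ dp2. *)
Definition omega : 'M[ratfun F]_4 :=
  delta_mx iq1 ip1 - delta_mx ip1 iq1 + delta_mx iq2 ip2 - delta_mx ip2 iq2.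

(* dx /\ dy + dz /\ dw = dq1 /\ dp1 + dq2 /\ dp2 for xi = (x, y, z, w). *)
Definition symplectic xi : Prop :=
  (jacobian xi)^T *m omega *m jacobian xi = omega.

(* Derivative of f along the flow dq_i = (dH/dp_i) dT, dp_i = - (dH/dq_i) dT,
   where dT f is the partial derivative with respect to the explicit time. *)
Definition flow (dT : ratfun F -> ratfun F) (H : {mpoly F[4]}) f : ratfun F :=
  dT f
  + pderiv iq1 f * tofrac (mderiv ip1 H) - pderiv ip1 f * tofrac (mderiv iq1 H)
  + pderiv iq2 f * tofrac (mderiv ip2 H) - pderiv ip2 f * tofrac (mderiv iq2 H).

Definition hamiltonian_direction (D : ratfun F -> ratfun F) xi
    (K : {mpoly F[4]}) : Prop :=
  [/\ D (xi iq1) = eval_at xi (mderiv ip1 K),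
      D (xi ip1) = - eval_at xi (mderiv iq1 K),
      D (xi iq2) = eval_at xi (mderiv ip2 K) &
      D (xi ip2) = - eval_at xi (mderiv iq2 K)].

(* xi = (x, y, z, w) satisfies the system
     dx =   K1_y dt + K2_y ds,   dy = - K1_x dt - K2_x ds,
     dz =   K1_w dt + K2_w ds,   dw = - K1_z dt - K2_z ds,
   Dt and Ds being the total derivatives in the two time directions. *)
Definition hamiltonian_system (Dt Ds : ratfun F -> ratfun F) xi
    (K1 K2 : {mpoly F[4]}) : Prop :=
  hamiltonian_direction Dt xi K1 /\ hamiltonian_direction Ds xi K2.

End PhaseSpace.

Section Times.
Variable R : realType.

Definition time_t : 'I_2 := @Ordinal 2 0 isT.
Definition time_s : 'I_2 := @Ordinal 2 1 isT.

Definition time (k : 'I_2) : ratfun (Cts R) := cst (tofrac 'X_k).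

Definition param (c : complex R) : ratfun (Cts R) :=
  cst (tofrac (mpolyC 2 c)).

(* Partial derivative with respect to t (k = time_t) or s (k = time_s), with
   q1, p1, q2, p2 held fixed: it acts on the coefficients. *)
Definition time_deriv (k : 'I_2) : ratfun (Cts R) -> ratfun (Cts R) :=
  frac_deriv (map_mpoly (frac_deriv (mderiv k))).

End Times.

Section Formulas.
Variable K : fieldType.

(* b0 does not occur; it is determined by b0 + b1 + 2 b2 + b3 + b4 = 1. *)
Definition HVI (q p t eta b0 b1 b2 b3 b4 : K) : K :=
  (q * (q - 1) * (q - eta) * (q - t) * p ^+ 2
   + (b1 * (t - eta) * q * (q - 1)
      + 2 * b2 * q * (q - 1) * (q - eta)
      + b3 * (t - 1) * q * (q - eta)
      + b4 * t * (q - 1) * (q - eta)) * p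
   + b2 * ((b1 + b2) * (t - eta) + b2 * (q - 1) + b3 * (t - 1) + t * b4) * q)
  / (t * (t - 1) * (t - eta)).

Definition Hformula (t s a0 a1 a2 a3 a4 a5 a6 q1 p1 q2 p2 : K) : K :=
  HVI q1 p1 t s a0 a1 a2 (a3 + 2 * a4 + a5) (a3 + a6)
  + HVI q2 p2 t s (a0 + 2 * a2 + a3) (a1 + a3) a4 a5 a6
  + 2 * (q1 - s) * q2 * ((q1 - t) * p1 + a2) * ((q2 - 1) * p2 + a4)
    / ((a0 + a1 + 2 * a2 + 2 * a3 + 2 * a4 + a5 + a6) * t * (t - 1) * (t - s)).

Definition Rtrans (t s a0 a1 a2 a3 a4 a5 a6 q1 p1 q2 p2 : K) (i : 'I_7) :
    'I_4 -> K :=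
  tnth (tnth
    [tuple
      [tuple - ((q1 - t) * p1 - a0) * p1; 1 / p1; q2; p2];
      [tuple - ((q1 - s) * p1 - a1) * p1; 1 / p1; q2; p2];
      [tuple 1 / q1; - (p1 * q1 + a2) * q1; q2; p2];
      [tuple - ((q1 - q2) * p1 - a3) * p1; 1 / p1; q2; p2 + p1];
      [tuple q1; p1; 1 / q2; - (p2 * q2 + a4) * q2];
      [tuple q1; p1; - ((q2 - 1) * p2 - a5) * p2; 1 / p2];
      [tuple q1; p1; - (q2 * p2 - a6) * p2; 1 / p2]] i).

End Formulas.

(* Main.v *)
Require Import Defs.
From HB Require Import structures.
From mathcomp Require Import all_boot all_order all_algebra.
From mathcomp Require Import perm generic_quotient fraction complex mpoly.
From mathcomp Require Import reals.
From mathcomp Require Import boolp ring.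

(** Each claim about a map [R_i] reduces to algebra in a field.

Polynomiality. Up to the denominator, [HVI] is quadratic in [p] with leading
coefficient vanishing at [q = 0], [1], [eta], [t] and with a pole at infinity.
At each finite point [c] the chart [x = - ((q - c) p - b) p], [y = 1 / p]
satisfies [(q - c) p = b - x y], so [q = c + y (b - x y)] is polynomial, one
factor [p] of [p ^+ 2] is absorbed, and the remaining single pole in [y] has a
coefficient that vanishes at [y = 0] when [b] is the parameter attached to [c].
At [c = t] that coefficient is instead 1, by the relation between the
parameters, which is why [p] has to be subtracted there.  At infinity the same happens with
[x = 1 / q].  These are five charts of one [HVI]
([HVI_chart_t], [HVI_chart_s], [HVI_chart_1], [HVI_chart_0], [HVI_chart_oo]).
The maps [R_0], [R_1], [R_2] act on [(q1, p1)] only and [R_4], [R_5], [R_6] on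
[(q2, p2)] only; the interaction term of the Hamiltonian is a product of one
factor in each pair, and each factor is polynomial in the charts of its pair.
Only [R_3] mixes the two copies, and there the poles of the three terms cancel
against each other ([Hformula_chart3]).  The second Hamiltonian is covered by
the exchange of [t] and [s], which exchanges [R_0] and [R_1]
([Hformula_swap_chart]).

Dynamics. For the bracket of [dq1 dp1 + dq2 dp2], the new coordinates satisfy
the canonical relations ([Rtrans_canonical]); inverting the Jacobian turns this
into invariance of the 2-form ([canonical_symplectic]).  The flow of [H] sends
[f] to [dT f + {f, H}].  If [H = K(xi) + c], the chain rule and the canonical
relations give Hamilton's equations for [K] as soon as
[dT (xi a) + {xi a, c} = 0] ([hamiltonian_transport]).  The last equation holds
with [c = p1] for the map whose centre moves with the time in question and with
[c = 0] for the others ([Rtrans_time_correction]).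

Birationality follows from explicit inverses ([RtransK], [RinverseK]) and from
the compatibility of composition with the field operations. *)

Set Implicit Arguments.
Unset Strict Implicit.
Unset Printing Implicit Defensive.

Import GRing.Theory.
Local Open Scope ring_scope.

(** * Polynomiality of the Hamiltonians in the charts *)

Ltac ring_membership :=
  repeat first
    [ assumption | apply: rpred0 | apply: rpred1 | apply: rpred_nat
    | apply: rpredB | apply: rpredD | apply: rpredM | apply: rpredX
    | rewrite rpredN ].

Lemma times_neq0 (K : fieldType) (t s : K) :
  t * (t - 1) * (t - s) != 0 -> [/\ t != 0, t - 1 != 0 & t - s != 0].
Proof. by rewrite !mulf_eq0 !negb_or -andbA => /and3P[]. Qed.

Section HVICharts.
Variables (K : fieldType) (S : subringClosed K).
Variables (q p t s b0 b1 b2 b3 b4 x y : K).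
Hypothesis dne : t * (t - 1) * (t - s) != 0.
Hypotheses (tS : t \in S) (sS : s \in S) (dS : (t * (t - 1) * (t - s))^-1 \in S).
Hypotheses (b0S : b0 \in S) (b1S : b1 \in S) (b2S : b2 \in S) (b3S : b3 \in S)
  (b4S : b4 \in S) (xS : x \in S) (yS : y \in S).

Lemma HVI_polynomial : q \in S -> p \in S ->
  HVI q p t s b0 b1 b2 b3 b4 \in S.
Proof.
by move=> qS pS; rewrite /HVI; ring_membership.
Qed.

(** With [v = (q - t) p = b0 - x y], the pole of [N (HVI - p)] in [y = 1 / p]
is single, with coefficient [b0 g(q) + B(q) - N], where [g(q) = q (q - 1) (q -
s)], [B] is the coefficient of [p] in [HVI] and [N] is its denominator.  It
vanishes at [q = t] by the relation between the parameters; the divided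
differences of [g] and [B] between [q] and [t] give the quotient by [q - t = y
v]. *)
Lemma HVI_chart_t : b0 + b1 + 2 * b2 + b3 + b4 = 1 ->
  p != 0 -> x = - ((q - t) * p - b0) * p -> y = 1 / p ->
  HVI q p t s b0 b1 b2 b3 b4 - p \in S.
Proof.
case: (times_neq0 dne) => t0 t10 ts0 sum1 pn0 xE yE.
pose v := b0 - x * y.
have qE : q = t + y * v by rewrite /v xE yE; field.
have vS : v \in S by rewrite /v; ring_membership.
have qS : q \in S by rewrite qE; ring_membership.
have -> : HVI q p t s b0 b1 b2 b3 b4 - p =
  (v * ((b0 + 2 * b2) * (q ^+ 2 + q * t + t ^+ 2 - (1 + s) * (q + t) + s)
        + b1 * (t - s) * (q + t - 1)
        + b3 * (t - 1) * (q + t - s) + b4 * t * (q + t - 1 - s))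
   - x * q * (q - 1) * (q - s)
   + b2 * ((b1 + b2) * (t - s) + b2 * (q - 1) + b3 * (t - 1) + t * b4) * q)
  * (t * (t - 1) * (t - s))^-1.
  have b0E : b0 = 1 - b1 - 2 * b2 - b3 - b4 by rewrite -{1}sum1; ring.
  by rewrite /v xE yE b0E /HVI; field; rewrite ?pn0 ?t0 ?t10 ?ts0.
ring_membership.
Qed.

(** Here [v = (q - s) p] and the singular part is [q (q - 1) p (v (q - t) + b1
(t - s))], where [v (q - t) + b1 (t - s) = b1 (q - s) - x y (q - t)] is
divisible by [y].  The charts at 1 and 0 work in the same way. *)
Lemma HVI_chart_s :
  p != 0 -> x = - ((q - s) * p - b1) * p -> y = 1 / p ->
  HVI q p t s b0 b1 b2 b3 b4 \in S.
Proof.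
case: (times_neq0 dne) => t0 t10 ts0 pn0 xE yE.
pose v := b1 - x * y.
have qE : q = s + y * v by rewrite /v xE yE; field.
have vS : v \in S by rewrite /v; ring_membership.
have qS : q \in S by rewrite qE; ring_membership.
have -> : HVI q p t s b0 b1 b2 b3 b4 =
  (q * (q - 1) * (b1 * v - x * (q - t))
   + v * (2 * b2 * q * (q - 1) + b3 * (t - 1) * q + b4 * t * (q - 1))
   + b2 * ((b1 + b2) * (t - s) + b2 * (q - 1) + b3 * (t - 1) + t * b4) * q)
  * (t * (t - 1) * (t - s))^-1.
  by rewrite /v xE yE /HVI; field; rewrite ?pn0 ?t0 ?t10 ?ts0.
ring_membership.
Qed.

Lemma HVI_chart_1 :
  p != 0 -> x = - ((q - 1) * p - b3) * p -> y = 1 / p ->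
  HVI q p t s b0 b1 b2 b3 b4 \in S.
Proof.
case: (times_neq0 dne) => t0 t10 ts0 pn0 xE yE.
pose v := b3 - x * y.
have qE : q = 1 + y * v by rewrite /v xE yE; field.
have vS : v \in S by rewrite /v; ring_membership.
have qS : q \in S by rewrite qE; ring_membership.
have -> : HVI q p t s b0 b1 b2 b3 b4 =
  (q * (q - s) * (b3 * v - x * (q - t))
   + v * (b1 * (t - s) * q + 2 * b2 * q * (q - s) + b4 * t * (q - s))
   + b2 * ((b1 + b2) * (t - s) + b2 * (q - 1) + b3 * (t - 1) + t * b4) * q)
  * (t * (t - 1) * (t - s))^-1.
  by rewrite /v xE yE /HVI; field; rewrite ?pn0 ?t0 ?t10 ?ts0.
ring_membership.
Qed.

Lemma HVI_chart_0 :
  p != 0 -> x = - (q * p - b4) * p -> y = 1 / p ->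
  HVI q p t s b0 b1 b2 b3 b4 \in S.
Proof.
case: (times_neq0 dne) => t0 t10 ts0 pn0 xE yE.
pose v := b4 - x * y.
have qE : q = y * v by rewrite /v xE yE; field.
have vS : v \in S by rewrite /v; ring_membership.
have qS : q \in S by rewrite qE; ring_membership.
have -> : HVI q p t s b0 b1 b2 b3 b4 =
  ((q - 1) * (q - s) * (b4 * v - x * (q - t))
   + v * (b1 * (t - s) * (q - 1) + 2 * b2 * (q - 1) * (q - s)
          + b3 * (t - 1) * (q - s))
   + b2 * ((b1 + b2) * (t - s) + b2 * (q - 1) + b3 * (t - 1) + t * b4) * q)
  * (t * (t - 1) * (t - s))^-1.
  by rewrite /v xE yE /HVI; field; rewrite ?pn0 ?t0 ?t10 ?ts0.
ring_membership.
Qed.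

(** With [v = x y + b2] one has [p q = - v].  The coefficient of [x ^- 2] is
[(v - b2) ^+ 2 = (x y) ^+ 2], and that of [x ^- 1] is divisible by [v - b2 = x
y]. *)
Lemma HVI_chart_oo :
  q != 0 -> x = 1 / q -> y = - (p * q + b2) * q ->
  HVI q p t s b0 b1 b2 b3 b4 \in S.
Proof.
case: (times_neq0 dne) => t0 t10 ts0 qn0 xE yE.
pose v := x * y + b2.
have vS : v \in S by rewrite /v; ring_membership.
have -> : HVI q p t s b0 b1 b2 b3 b4 =
  (y ^+ 2
   - y * ((1 + s + t) * v + b1 * (t - s) + b3 * (t - 1) + b4 * t
          + b2 * (t - 1 - s))
   + v * ((s + t + s * t) * v + b1 * (t - s) - 2 * b2 * s + b3 * (t - 1) * s
          + b4 * t * (1 + s))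
   - s * t * x * v * (v + b4))
  * (t * (t - 1) * (t - s))^-1.
  by rewrite /v xE yE /HVI; field; rewrite ?qn0 ?t0 ?t10 ?ts0.
ring_membership.
Qed.
End HVICharts.

Section HamiltonianCharts.
Variables (K : fieldType) (S : subringClosed K).
Variables (t s a0 a1 a2 a3 a4 a5 a6 q1 p1 q2 p2 : K).
Hypothesis sum1 : a0 + a1 + 2 * a2 + 2 * a3 + 2 * a4 + a5 + a6 = 1.
Hypothesis dne : t * (t - 1) * (t - s) != 0.
Hypotheses (tS : t \in S) (sS : s \in S) (dS : (t * (t - 1) * (t - s))^-1 \in S).
Hypotheses (a0S : a0 \in S) (a1S : a1 \in S) (a2S : a2 \in S) (a3S : a3 \in S)
  (a4S : a4 \in S) (a5S : a5 \in S) (a6S : a6 \in S).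

Local Notation H := (Hformula t s a0 a1 a2 a3 a4 a5 a6 q1 p1 q2 p2).
Local Notation HVI1 := (HVI q1 p1 t s a0 a1 a2 (a3 + 2 * a4 + a5) (a3 + a6)).
Local Notation HVI2 := (HVI q2 p2 t s (a0 + 2 * a2 + a3) (a1 + a3) a4 a5 a6).

(** The interaction term factors into one function of each canonical pair, so
it can be checked on each pair separately. *)
Lemma Hformula_split c : HVI1 + HVI2 - c \in S ->
  (q1 - s) * ((q1 - t) * p1 + a2) \in S ->
  q2 * ((q2 - 1) * p2 + a4) \in S -> H - c \in S.
Proof.
move=> hS c1S c2S.
have -> : H - c = HVI1 + HVI2 - c
   + 2 * ((q1 - s) * ((q1 - t) * p1 + a2)) * (q2 * ((q2 - 1) * p2 + a4))
     * (t * (t - 1) * (t - s))^-1.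
  rewrite /Hformula sum1 mul1r; ring.
ring_membership.
Qed.

Lemma Hformula_polynomial :
  q1 \in S -> p1 \in S -> q2 \in S -> p2 \in S -> H \in S.
Proof.
move=> q1S p1S q2S p2S; rewrite -[H]subr0.
by apply: Hformula_split; ring_membership.
Qed.

(** With [v = (q1 - q2) p1 = a3 - x y] and [p2 = w - p1], the terms quadratic
in [p1] have a coefficient divisible by [q1 - q2 = y v], because [A(q1) +
A(q2) - 2 (q1 - s) (q1 - t) q2 (q2 - 1)] vanishes at [q1 = q2] for [A(q) = q
(q - 1) (q - s) (q - t)].  This lowers the pole to a single one, whose
coefficient again vanishes at [q1 = q2] once [v] is replaced by [a3]. *)
Lemma Hformula_chart3 :
  p1 != 0 -> - ((q1 - q2) * p1 - a3) * p1 \in S -> 1 / p1 \in S ->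
  q2 \in S -> p2 + p1 \in S -> H \in S.
Proof.
case: (times_neq0 dne) => t0 t10 ts0 pn0.
set x := - _ * p1; set y := 1 / p1; set w := p2 + p1 => xS yS q2S wS.
pose v := a3 - x * y.
have q1E : q1 = q2 + y * v by rewrite /v /x /y; field.
have vS : v \in S by rewrite /v; ring_membership.
have q1S : q1 \in S by rewrite q1E; ring_membership.
have -> : H =
  (v * (a1 * (t - s) * (q1 + q2 - 1) + 2 * a2 * (q1 - s) * (q1 + q2 - 1)
        + a3 * ((q1 - s) * (q1 + 2 * q2 - 2 + t) + q2 * (q2 - 1))
        + 2 * a4 * ((t - 1 + q2) * (q1 + q2 - s) - q2 * t)
        + a5 * (t - 1) * (q1 + q2 - s) + a6 * t * (q1 + q2 - 1 - s)
        + 2 * w * q2 * (q2 - 1) * (q1 + q2 - s - t))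
   - x * ((q1 - s) * (q1 - t) * (q1 + q2 - 1)
          - q2 * (q2 - 1) * (q1 + q2 - s - t))
   + 2 * a2 * (q1 - s) * q2 * ((q2 - 1) * w + a4)
   + a2 * ((a1 + a2) * (t - s) + a2 * (q1 - 1) + (a3 + 2 * a4 + a5) * (t - 1)
           + t * (a3 + a6)) * q1)
  * (t * (t - 1) * (t - s))^-1
  + HVI q2 w t s (a0 + 2 * a2 + a3) (a1 + a3) a4 a5 a6.
  rewrite /Hformula sum1 mul1r /v /x /y /w /HVI; field.
  by rewrite ?pn0 ?t0 ?t10 ?ts0.
apply: rpredD; first by ring_membership.
apply: HVI_polynomial => //; ring_membership.
Qed.

Lemma Hformula_chart (i : 'I_7) :
  q1 != 0 -> p1 != 0 -> q2 != 0 -> p2 != 0 ->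
  (forall a, Rtrans t s a0 a1 a2 a3 a4 a5 a6 q1 p1 q2 p2 i a \in S) ->
  H - (if nat_of_ord i == 0%N then p1 else 0) \in S.
Proof.
move=> q1n p1n q2n p2n RS.
have := RS iq1; have := RS ip1; have := RS iq2; have := RS ip2.
case: i {RS} => [[|[|[|[|[|[|[|//]]]]]]] ?];
  rewrite /Rtrans /tnth /= ?subr0 => wS zS yS xS.
- apply: Hformula_split.
  + rewrite addrAC; apply: rpredD; last by apply: HVI_polynomial; ring_membership.
    apply: HVI_chart_t yS _ p1n erefl erefl => //; try by ring_membership.
    by rewrite -[RHS]sum1; ring.
  + have -> : (q1 - s) * ((q1 - t) * p1 + a2) =
      (let x := - ((q1 - t) * p1 - a0) * p1 in let y := 1 / p1 in
       (t - s + y * (a0 - x * y)) * (a0 - x * y + a2)) by rewrite /=; field.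
    by rewrite /=; ring_membership.
  + by ring_membership.
- rewrite -[H]subr0; apply: Hformula_split; rewrite ?subr0.
  + apply: rpredD; last by apply: HVI_polynomial; ring_membership.
    by apply: HVI_chart_s yS _ erefl erefl; ring_membership.
  + have -> : (q1 - s) * ((q1 - t) * p1 + a2) =
      (let x := - ((q1 - s) * p1 - a1) * p1 in let y := 1 / p1 in
       (s - t + y * (a1 - x * y)) * (a1 - x * y) + a2 * (y * (a1 - x * y)))
      by rewrite /=; field.
    by rewrite /=; ring_membership.
  + by ring_membership.
- rewrite -[H]subr0; apply: Hformula_split; rewrite ?subr0.
  + apply: rpredD; last by apply: HVI_polynomial; ring_membership.
    by apply: HVI_chart_oo yS _ erefl erefl; ring_membership.
  + have -> : (q1 - s) * ((q1 - t) * p1 + a2) =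
      (let x := 1 / q1 in let y := - (p1 * q1 + a2) * q1 in
       (1 - s * x) * (t * (x * y + a2) - y)) by rewrite /=; field.
    by rewrite /=; ring_membership.
  + by ring_membership.
- exact: Hformula_chart3.
- rewrite -[H]subr0; apply: Hformula_split; rewrite ?subr0.
  + apply: rpredD; first by apply: HVI_polynomial; ring_membership.
    by apply: HVI_chart_oo wS _ erefl erefl; ring_membership.
  + by ring_membership.
  + have -> : q2 * ((q2 - 1) * p2 + a4) =
      (let z := 1 / q2 in let w := - (p2 * q2 + a4) * q2 in
       (z * w + a4) - w) by rewrite /=; field.
    by rewrite /=; ring_membership.
- rewrite -[H]subr0; apply: Hformula_split; rewrite ?subr0.
  + apply: rpredD; first by apply: HVI_polynomial; ring_membership.
    by apply: HVI_chart_1 wS _ erefl erefl; ring_membership.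
  + by ring_membership.
  + have -> : q2 * ((q2 - 1) * p2 + a4) =
      (let z := - ((q2 - 1) * p2 - a5) * p2 in let w := 1 / p2 in
       (1 + w * (a5 - z * w)) * (a5 - z * w + a4)) by rewrite /=; field.
    by rewrite /=; ring_membership.
- rewrite -[H]subr0; apply: Hformula_split; rewrite ?subr0.
  + apply: rpredD; first by apply: HVI_polynomial; ring_membership.
    by apply: HVI_chart_0 wS _ erefl erefl; ring_membership.
  + by ring_membership.
  + have -> : q2 * ((q2 - 1) * p2 + a4) =
      (let z := - (q2 * p2 - a6) * p2 in let w := 1 / p2 in
       (w * (a6 - z * w) - 1) * (a6 - z * w) + a4 * (w * (a6 - z * w)))
      by rewrite /=; field.
    by rewrite /=; ring_membership.
Qed.
End HamiltonianCharts.

(** * Derivations, brackets and the action of the maps on them *)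

Definition derivation (A : comNzRingType) (D : A -> A) : Prop :=
  (forall f g, D (f + g) = D f + D g) /\
  (forall f g, D (f * g) = D f * g + f * D g).

Section Derivations.
Variables (A : comNzRingType) (D : A -> A).
Hypothesis derD : derivation D.

Lemma derivation0 : D 0 = 0.
Proof. by apply: (@addrI _ (D 0)); rewrite -(proj1 derD) !addr0. Qed.

Lemma derivationN f : D (- f) = - D f.
Proof. by apply: (@addrI _ (D f)); rewrite -(proj1 derD) !subrr derivation0. Qed.

Lemma derivation1 : D 1 = 0.
Proof.
apply: (@addrI _ (D 1)); rewrite addr0 -[in RHS](mulr1 1) (proj2 derD).
by rewrite mulr1 mul1r.
Qed.

Lemma derivation_sum (I : Type) (r : seq I) (P : pred I) (F : I -> A) :
  D (\sum_(i <- r | P i) F i) = \sum_(i <- r | P i) D (F i).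
Proof. exact: (big_morph D (proj1 derD) derivation0). Qed.

Lemma derivation_neq0 f : D f = 1 -> f != 0.
Proof.
by move=> Df; apply: contra_eq_neq Df => ->;
  rewrite derivation0 eq_sym oner_neq0.
Qed.

(** Used to separate elements such as [t] and [s] by a partial derivative. *)
Lemma derivationB_neq0 f g : D f = 1 -> D g = 0 -> f - g != 0.
Proof.
move=> Df Dg; apply: derivation_neq0.
by rewrite (proj1 derD) derivationN Df Dg oppr0 addr0.
Qed.

End Derivations.

Lemma derivationV (K : fieldType) (D : K -> K) f :
  derivation D -> D f^-1 = - D f / f ^+ 2.
Proof.
move=> derD; have [->|fn0] := eqVneq f 0.
  by rewrite invr0 expr0n invr0 mulr0 derivation0.
have : D (f * f^-1) = 0 by rewrite mulfV // derivation1.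
rewrite (proj2 derD) => /(canRL (addKr _)) /(canRL (mulKf fn0)) ->.
by field.
Qed.

Section Brackets.
Variables (K : fieldType) (B : K -> K -> K).

(** A Poisson bracket without the Jacobi identity. *)
Definition alternating_biderivation : Prop :=
  [/\ forall g, derivation (B^~ g), forall f, derivation (B f) &
      forall f, B f f = 0].

Definition casimir (c : K) : Prop := forall f, B c f = 0.

Definition canonical_coordinates (xi : 'I_4 -> K) : Prop :=
  [/\ B (xi iq1) (xi ip1) = 1, B (xi iq2) (xi ip2) = 1 &
   [/\ B (xi iq1) (xi iq2) = 0, B (xi iq1) (xi ip2) = 0,
       B (xi ip1) (xi iq2) = 0 & B (xi ip1) (xi ip2) = 0]].

Hypothesis bB : alternating_biderivation.

Lemma biderivation_skew f g : B f g = - B g f.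
Proof.
case: bB => dl dr b0; have := b0 (f + g).
rewrite (proj1 (dl _)) !(proj1 (dr _)) !b0 add0r addr0.
by move/eqP; rewrite addr_eq0 => /eqP.
Qed.

Lemma biderivationDl f g h : B (f + g) h = B f h + B g h.
Proof. by case: bB => dl _ _; rewrite (proj1 (dl h)). Qed.
Lemma biderivationDr f g h : B h (f + g) = B h f + B h g.
Proof. by case: bB => _ dr _; rewrite (proj1 (dr h)). Qed.
Lemma biderivationMl f g h : B (f * g) h = B f h * g + f * B g h.
Proof. by case: bB => dl _ _; rewrite (proj2 (dl h)). Qed.
Lemma biderivationMr f g h : B h (f * g) = B h f * g + f * B h g.
Proof. by case: bB => _ dr _; rewrite (proj2 (dr h)). Qed.
Lemma biderivationNl f h : B (- f) h = - B f h.
Proof. by case: bB => dl _ _; rewrite (derivationN (dl h)). Qed.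
Lemma biderivationNr f h : B h (- f) = - B h f.
Proof. by case: bB => _ dr _; rewrite (derivationN (dr h)). Qed.
Lemma biderivationVl f h : B f^-1 h = - B f h / f ^+ 2.
Proof. by case: bB => dl _ _; rewrite (derivationV f (dl h)). Qed.
Lemma biderivationVr f h : B h f^-1 = - B h f / f ^+ 2.
Proof. by case: bB => _ dr _; rewrite (derivationV f (dr h)). Qed.
Lemma biderivation1l h : B 1 h = 0.
Proof. by case: bB => dl _ _; rewrite (derivation1 (dl h)). Qed.
Lemma biderivation1r h : B h 1 = 0.
Proof. by case: bB => _ dr _; rewrite (derivation1 (dr h)). Qed.
Lemma casimirr c : casimir c -> forall h, B h c = 0.
Proof. by move=> cc h; rewrite biderivation_skew cc oppr0. Qed.
Lemma biderivationxx f : B f f = 0. Proof. by case: bB. Qed.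
Local Notation rules :=
  (div1r, biderivationDl, biderivationDr, biderivationMl,
   biderivationMr, biderivationNl, biderivationNr, biderivationVl,
   biderivationVr, biderivation1l, biderivation1r, biderivationxx).

Variables t s a0 a1 a2 a3 a4 a5 a6 q1 p1 q2 p2 : K.
Hypotheses (tC : casimir t) (sC : casimir s).
Hypotheses (a0C : casimir a0) (a1C : casimir a1) (a2C : casimir a2)
  (a3C : casimir a3) (a4C : casimir a4) (a5C : casimir a5) (a6C : casimir a6).
Hypotheses (q1_neq0 : q1 != 0) (p1_neq0 : p1 != 0) (q2_neq0 : q2 != 0)
  (p2_neq0 : p2 != 0).
Hypothesis canB : canonical_coordinates (tnth [tuple q1; p1; q2; p2]).

Lemma Rtrans_canonical (i : 'I_7) :
  canonical_coordinates (Rtrans t s a0 a1 a2 a3 a4 a5 a6 q1 p1 q2 p2 i).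
Proof.
case: canB => b12 b34 []; rewrite /tnth /= in b12 b34 * => b13 b14 b23 b24.
have skew := (biderivation_skew p1 q1, biderivation_skew p2 q2,
  biderivation_skew q2 q1, biderivation_skew p2 q1,
  biderivation_skew q2 p1, biderivation_skew p2 p1).
have cas := (casimirr a0C, casimirr a1C, casimirr a2C, casimirr a3C,
  casimirr a4C, casimirr a5C, casimirr a6C, casimirr tC, casimirr sC,
  a0C, a1C, a2C, a3C, a4C, a5C, a6C, tC, sC).
case: i => [[|[|[|[|[|[|[|//]]]]]]] ?];
  (split; [| |split]); rewrite /Rtrans /tnth /=;
  rewrite ?(rules, cas) ?skew ?(b12, b34, b13, b14, b23, b24);
  by field; rewrite ?q1_neq0 ?p1_neq0 ?q2_neq0 ?p2_neq0.
Qed.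

Variable D : K -> K.
Hypothesis derD : derivation D.
Hypotheses (a0D : D a0 = 0) (a1D : D a1 = 0) (a2D : D a2 = 0) (a3D : D a3 = 0)
  (a4D : D a4 = 0) (a5D : D a5 = 0) (a6D : D a6 = 0).
Hypotheses (q1D : D q1 = 0) (p1D : D p1 = 0) (q2D : D q2 = 0) (p2D : D p2 = 0).
Hypotheses (DtC : casimir (D t)) (DsC : casimir (D s)).

(** Only [R_0] and [R_1] involve the times explicitly, each through the centre
of its first coordinate, and that dependence is generated by [p1]. *)
Lemma Rtrans_time_correction (i : 'I_7) (a : 'I_4) :
  D (Rtrans t s a0 a1 a2 a3 a4 a5 a6 q1 p1 q2 p2 i a)
  + B (Rtrans t s a0 a1 a2 a3 a4 a5 a6 q1 p1 q2 p2 i a)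
      (if nat_of_ord i == 0%N then D t * p1
       else if nat_of_ord i == 1%N then D s * p1 else 0) = 0.
Proof.
have dN f : D (- f) = - D f by exact: derivationN.
have dV f : D f^-1 = - D f / f ^+ 2 by exact: derivationV.
have dD f g : D (f + g) = D f + D g by rewrite (proj1 derD).
have dM f g : D (f * g) = D f * g + f * D g by rewrite (proj2 derD).
have d1 : D 1 = 0 by exact: derivation1.
have dC := (a0D, a1D, a2D, a3D, a4D, a5D, a6D, q1D, p1D, q2D, p2D).
case: canB => b12 b34 []; rewrite /tnth /= in b12 b34 * => b13 b14 b23 b24.
have skew := (biderivation_skew p1 q1, biderivation_skew p2 q2,
  biderivation_skew q2 q1, biderivation_skew p2 q1,
  biderivation_skew q2 p1, biderivation_skew p2 p1).
have cas := (casimirr a0C, casimirr a1C, casimirr a2C, casimirr a3C,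
  casimirr a4C, casimirr a5C, casimirr a6C, casimirr tC, casimirr sC, casimirr DtC, casimirr DsC,
  a0C, a1C, a2C, a3C, a4C, a5C, a6C, tC, sC).
have b0 f : B f 0 = 0 by case: bB => _ dr _; rewrite (derivation0 (dr f)).
case: i a => [[|[|[|[|[|[|[|//]]]]]]] ?] [[|[|[|[|//]]]] ?];
  rewrite /Rtrans /tnth /=;
  rewrite ?div1r ?(dN, dV, dD, dM, d1, dC) ?(b0, rules, cas) ?skew
    ?(b12, b34, b13, b14, b23, b24);
  by field; rewrite ?q1_neq0 ?p1_neq0 ?q2_neq0 ?p2_neq0.
Qed.
End Brackets.

(** The form of the canonical bracket in two degrees of freedom. *)
Lemma wedge_biderivation (K : fieldType) (d1 d2 d3 d4 : K -> K) :
  derivation d1 -> derivation d2 -> derivation d3 -> derivation d4 ->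
  alternating_biderivation (fun f g =>
    d1 f * d2 g - d2 f * d1 g + d3 f * d4 g - d4 f * d3 g).
Proof.
move=> [D1 M1] [D2 M2] [D3 M3] [D4 M4].
by split=> [g|f|f]; try split=> h k;
  rewrite ?(D1, D2, D3, D4) ?(M1, M2, M3, M4); ring.
Qed.

(** * Derivations of fraction fields and of polynomial rings *)

Lemma frac_eq_div (A : idomainType) (f : {fraction A}) :
  f = tofrac \n_(repr f) / tofrac \d_(repr f).
Proof.
have dn : tofrac \d_(repr f) != 0 by rewrite tofrac_eq0 denom_ratioP.
apply: (canRL (mulfK dn)).
have -> : tofrac \d_(repr f)
    = (\pi_({fraction A}) (Ratio \d_(repr f) 1))%qT by unlock FracField.tofrac.
have -> : tofrac \n_(repr f)
    = (\pi_({fraction A}) (Ratio \n_(repr f) 1))%qT by unlock FracField.tofrac.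
rewrite -{1}[f]reprK -[LHS]FracField.pi_mul /FracField.mulf.
apply/eqmodP; rewrite /= FracField.equivfE.
rewrite !numden_Ratio ?oner_neq0 ?mulr1 ?mulf_neq0 ?oner_neq0 ?denom_ratioP //.
by rewrite mulrC.
Qed.

(** The quotient rule as identities in an abstract field, with the derivatives
of numerators and denominators as independent unknowns. *)
Section QuotientRule.
Variable K : fieldType.
Implicit Types n d : K.

Lemma quotient_rule_unique n d n' d' Dn Dd Dn' Dd' :
  d != 0 -> d' != 0 -> n * d' = n' * d ->
  Dn * d' + n * Dd' = Dn' * d + n' * Dd ->
  (Dn' * d' - n' * Dd') / d' ^+ 2 = (Dn * d - n * Dd) / d ^+ 2.
Proof.
move=> d0 d0' nE DnE.
have -> : n = n' * d / d' by rewrite -nE mulfK.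
have -> : Dn = (Dn' * d + n' * Dd - n' * d / d' * Dd') / d'.
  by rewrite -DnE -nE mulfK // addrK mulfK.
by field; rewrite d0 d0'.
Qed.

Lemma quotient_ruleD n d m e Dn Dd Dm De : d != 0 -> e != 0 ->
  (((Dn * e + n * De) + (Dm * d + m * Dd)) * (d * e)
    - (n * e + m * d) * (Dd * e + d * De)) / (d * e) ^+ 2 =
  (Dn * d - n * Dd) / d ^+ 2 + (Dm * e - m * De) / e ^+ 2.
Proof. by move=> d0 e0; field; rewrite d0 e0. Qed.

Lemma quotient_ruleM n d m e Dn Dd Dm De : d != 0 -> e != 0 ->
  ((Dn * m + n * Dm) * (d * e) - (n * m) * (Dd * e + d * De)) / (d * e) ^+ 2 =
  (Dn * d - n * Dd) / d ^+ 2 * (m / e) + n / d * ((Dm * e - m * De) / e ^+ 2).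
Proof. by move=> d0 e0; field; rewrite d0 e0. Qed.

End QuotientRule.

Section FracDeriv.
Variables (A : idomainType) (D : A -> A).
Hypothesis derD : derivation D.

(** The representative chosen by [frac_deriv] can be replaced by any other,
since a derivation respects the cross-multiplied equality of two fractions. *)
Lemma frac_deriv_div n d : d != 0 ->
  frac_deriv D (tofrac n / tofrac d) =
  (tofrac (D n) * tofrac d - tofrac n * tofrac (D d)) / tofrac d ^+ 2.
Proof.
move=> dn0; rewrite /frac_deriv.
set f := tofrac n / _; set n' := \n_(repr f); set d' := \d_(repr f).
have fE : tofrac n / tofrac d = tofrac n' / tofrac d' := frac_eq_div f.
have d'n0 : tofrac d' != 0 by rewrite tofrac_eq0 denom_ratioP.
have dn0' : tofrac d != 0 by rewrite tofrac_eq0.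
have cross : n * d' = n' * d.
  apply/eqP; rewrite -tofrac_eq !tofracM; apply/eqP.
  by apply/eqP; rewrite -eqr_div // fE.
apply: quotient_rule_unique; rewrite // -!tofracM ?cross //.
by rewrite -!tofracD -!(proj2 derD) cross.
Qed.

Lemma frac_deriv_tofrac n : frac_deriv D (tofrac n) = tofrac (D n).
Proof.
have := frac_deriv_div n (oner_neq0 A).
by rewrite tofrac1 divr1 (derivation1 derD) tofrac0 mulr0 subr0 mulr1
  expr1n divr1.
Qed.

Lemma frac_deriv_derivation : derivation (frac_deriv D).
Proof.
have repf (f : {fraction A}) : exists n d : A,
    d != 0 /\ f = tofrac n / tofrac d.
  exists \n_(repr f), \d_(repr f); split; first exact: denom_ratioP.
  exact: frac_eq_div.
split=> f g; have [n [d [d0 ->]]] := repf f; have [m [e [e0 ->]]] := repf g.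
- have -> : tofrac n / tofrac d + tofrac m / tofrac e
      = tofrac (n * e + m * d) / tofrac (d * e).
    by rewrite tofracD !tofracM addf_div ?tofrac_eq0.
  rewrite !frac_deriv_div ?mulf_neq0 // !(proj1 derD) !(proj2 derD).
  by rewrite !(tofracD, tofracM) quotient_ruleD ?tofrac_eq0.
- have -> : tofrac n / tofrac d * (tofrac m / tofrac e)
      = tofrac (n * m) / tofrac (d * e) by rewrite !tofracM mulf_div.
  rewrite !frac_deriv_div ?mulf_neq0 // !(proj2 derD).
  by rewrite !(tofracD, tofracM) quotient_ruleM ?tofrac_eq0.
Qed.
End FracDeriv.

Lemma mderiv_derivation (n : nat) (A : comNzRingType) (i : 'I_n) :
  derivation (@mderiv n A i).
Proof. by split; [exact: mderivD | exact: mderivM]. Qed.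

Section CoefficientDerivation.
Variables (n : nat) (A : comNzRingType) (D : A -> A).
Hypothesis derD : derivation D.

Lemma mcoeff_map_derivation (p : {mpoly A[n]}) m :
  (map_mpoly D p)@_m = D p@_m.
Proof.
have Dzmod : zmod_morphism D.
  by move=> f g; rewrite (proj1 derD) (derivationN derD).
pose D' : {additive A -> A} :=
  HB.pack D (GRing.isZmodMorphism.Build A A D Dzmod).
exact: (mcoeff_map_mpoly D').
Qed.

Lemma map_mpoly_derivation : derivation (map_mpoly D : {mpoly A[n]} -> _).
Proof.
split=> p q; apply/mpolyP=> m.
  by rewrite mcoeffD !mcoeff_map_derivation mcoeffD (proj1 derD).
rewrite mcoeffD mcoeff_map_derivation !mcoeffM.
rewrite (derivation_sum derD) -big_split /=.
by apply: eq_bigr => k _; rewrite (proj2 derD) !mcoeff_map_derivation.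
Qed.

Lemma map_derivationC c : map_mpoly D c%:MP_[n] = (D c)%:MP_[n].
Proof.
apply/mpolyP=> m; rewrite mcoeff_map_derivation !mcoeffC.
by case: eqP; rewrite ?mulr1 ?mulr0 ?(derivation0 derD).
Qed.

Lemma map_derivationX i : map_mpoly D ('X_i : {mpoly A[n]}) = 0.
Proof.
apply/mpolyP=> m; rewrite mcoeff_map_derivation mcoeffX mcoeff0.
by case: eqP; rewrite ?(derivation1 derD) ?(derivation0 derD).
Qed.
End CoefficientDerivation.

(** * Calculus on the phase space *)

HB.instance Definition _ (F : fieldType) :=
  GRing.RMorphism.copy (@cst F) (@tofrac _ \o @mpolyC 4 F).

HB.instance Definition _ (F : fieldType) (xi : 'I_4 -> ratfun F) :=
  GRing.RMorphism.copy (eval_at xi) (mmap (@cst F) xi).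

(** [J *m w *m J^T = w] exhibits an inverse of [J], which then also solves the
transposed equation. *)
Lemma transpose_isometry (K : fieldType) n (J w : 'M[K]_n) :
  w *m w = - 1%:M -> J *m w *m J^T = w -> J^T *m w *m J = w.
Proof.
move=> ww JwJ.
have : J *m (- (w *m J^T *m w)) = 1%:M.
  by rewrite mulmxN !mulmxA JwJ ww opprK.
move=> /mulmx1C /(congr1 (mulmx (- w))).
rewrite mulmx1 !mulNmx mulmxN opprK !mulmxA ww !mulNmx mul1mx.
by move/oppr_inj.
Qed.

Lemma mderiv_var n (A : comNzRingType) (a b : 'I_n) :
  mderiv a ('X_b : {mpoly A[n]}) = (a == b)%:R.
Proof.
rewrite mderivX mnm1E eq_sym; case: eqP => [->|_]; last by rewrite scale0r.
by rewrite scale1r -{1}[U_(b)%MM]add0m addmK mpolyX0.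
Qed.

Section SymplecticForm.
Variable K : fieldType.

Local Notation w := (delta_mx iq1 ip1 - delta_mx ip1 iq1
  + delta_mx iq2 ip2 - delta_mx ip2 iq2 : 'M[K]_4).

Lemma symplectic_form_sqr : w *m w = - 1%:M.
Proof.
apply/matrixP=> a b; rewrite mxE !big_ord_recl big_ord0 !mxE.
by case: a => [[|[|[|[|//]]]] ?]; case: b => [[|[|[|[|//]]]] ?];
  rewrite /= ?(mul0r, mulr0, mulr1, subr0, sub0r, addr0, add0r, oppr0,
    mulN1r, mulrN1, mul1r).
Qed.

Lemma mulmx_delta (A B : 'M[K]_4) i j a b :
  (A *m delta_mx i j *m B) a b = A a i * B j b.
Proof.
rewrite -(mul_delta_mx (0 : 'I_1)) mulmxA -colE -mulmxA -rowE.
by rewrite mxE big_ord_recl big_ord0 !mxE addr0.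
Qed.

Lemma symplectic_form_entry (J : 'M[K]_4) a b :
  (J *m w *m J^T) a b = J a iq1 * J b ip1 - J a ip1 * J b iq1
    + J a iq2 * J b ip2 - J a ip2 * J b iq2.
Proof.
have mxD (A B : 'M[K]_4) : (A + B) a b = A a b + B a b by rewrite mxE.
have mxB (A B : 'M[K]_4) : (A - B) a b = A a b - B a b by rewrite !mxE.
have trE c d : J^T c d = J d c by rewrite mxE.
rewrite !(mulmxDr, mulmxN, mulmxDl, mulNmx) mxB mxD mxB !mulmx_delta.
by rewrite !trE.
Qed.
End SymplecticForm.

Section PhaseSpaceCalculus.
Variable F : fieldType.
Implicit Types (xi : 'I_4 -> ratfun F) (P : {mpoly F[4]}) (f g : ratfun F).

Lemma pderiv_derivation a : derivation (@pderiv F a).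
Proof. exact/frac_deriv_derivation/mderiv_derivation. Qed.

Lemma pderiv_tofrac a P : pderiv a (tofrac P) = tofrac (mderiv a P).
Proof. exact/frac_deriv_tofrac/mderiv_derivation. Qed.

Lemma pderiv_cst a (c : F) : pderiv a (cst c) = 0.
Proof. by rewrite pderiv_tofrac mderivC tofrac0. Qed.

Lemma pderiv_var a b : pderiv a (phase_var F b) = (a == b)%:R.
Proof. by rewrite pderiv_tofrac mderiv_var rmorph_nat. Qed.

Lemma phase_var_neq0 a : phase_var F a != 0.
Proof.
by apply: (derivation_neq0 (pderiv_derivation a)); rewrite pderiv_var eqxx.
Qed.

Lemma eval_atC xi c : eval_at xi c%:MP = cst c.
Proof. exact: mmapC. Qed.

Lemma eval_atX xi a : eval_at xi 'X_a = xi a.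
Proof. by rewrite /eval_at mmapX mmap1U. Qed.

Lemma eval_atD xi P Q : eval_at xi (P + Q) = eval_at xi P + eval_at xi Q.
Proof. exact: (rmorphD (eval_at xi)). Qed.

Lemma eval_atM xi P Q : eval_at xi (P * Q) = eval_at xi P * eval_at xi Q.
Proof. exact: (rmorphM (eval_at xi)). Qed.

(** Induction suited to ring morphisms and derivations, for which products are
easier to handle than monomials. *)
Lemma mpoly_ring_ind (Q : {mpoly F[4]} -> Prop) :
  (forall c, Q c%:MP) -> (forall i, Q 'X_i) ->
  (forall p q, Q p -> Q q -> Q (p + q)) ->
  (forall p q, Q p -> Q q -> Q (p * q)) -> forall p, Q p.
Proof.
move=> QC QX QD QM; elim/mpolyind => [|c m P _ _ QP]; first by rewrite -mpolyC0.
apply: QD => //; rewrite -mul_mpolyC; apply: (QM _ _ (QC c)).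
rewrite mpolyXE_id; apply: (big_ind Q) => [|p q|i _];
  [by rewrite -mpolyC1 | exact: QM | ].
elim: (m i) => [|k IH]; first by rewrite expr0 -mpolyC1.
by rewrite exprS; apply: QM (QX i) IH.
Qed.

Lemma eval_at_phase_var P : eval_at (phase_var F) P = tofrac P.
Proof.
elim/mpoly_ring_ind: P => [c|i|p q IHp IHq|p q IHp IHq].
- exact: eval_atC.
- exact: eval_atX.
- by rewrite eval_atD tofracD IHp IHq.
- by rewrite eval_atM tofracM IHp IHq.
Qed.

(** Chain rule for a derivation that kills the coefficients. *)
Lemma derivation_eval_at (D : ratfun F -> ratfun F) xi P :
  derivation D -> (forall c, D (cst c) = 0) ->
  D (eval_at xi P) = \sum_b eval_at xi (mderiv b P) * D (xi b).
Proof.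
move=> derD Dc; elim/mpoly_ring_ind: P => [c|i|p q IHp IHq|p q IHp IHq].
- rewrite eval_atC Dc big1 // => b _.
  by rewrite mderivC rmorph0 mul0r.
- rewrite eval_atX (bigD1 i) //= big1 ?addr0 => [|b bi].
    by rewrite mderiv_var eqxx rmorph1 mul1r.
  by rewrite mderiv_var (negPf bi) rmorph0 mul0r.
- rewrite eval_atD (proj1 derD) IHp IHq -big_split /=.
  by apply: eq_bigr => b _; rewrite mderivD eval_atD mulrDl.
- rewrite eval_atM (proj2 derD) IHp IHq mulr_suml mulr_sumr -big_split /=.
  apply: eq_bigr => b _; rewrite mderivM eval_atD !eval_atM mulrDl.
  by rewrite mulrAC [in LHS]mulrA.
Qed.

Definition bracket f g : ratfun F :=
  pderiv iq1 f * pderiv ip1 g - pderiv ip1 f * pderiv iq1 g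
  + pderiv iq2 f * pderiv ip2 g - pderiv ip2 f * pderiv iq2 g.

Lemma bracket_biderivation : alternating_biderivation bracket.
Proof. by apply: wedge_biderivation; exact: pderiv_derivation. Qed.

Lemma casimir_cst (c : F) : casimir bracket (cst c).
Proof. by move=> f; rewrite /bracket !pderiv_cst !mul0r !subr0 addr0. Qed.

Lemma phase_var_canonical : canonical_coordinates bracket (phase_var F).
Proof.
split; [| |split]; rewrite /bracket !pderiv_var /=;
by rewrite ?(mulr0n, mulr1n) ?(mul0r, mulr0, mulr1, subr0, oppr0, addr0, add0r).
Qed.

Lemma bracket_omega xi a b : canonical_coordinates bracket xi ->
  bracket (xi a) (xi b) = omega F a b.
Proof.
case=> b12 b34 [b13 b14 b23 b24].
have skew f g := biderivation_skew bracket_biderivation f g.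
have brxx f : bracket f f = 0 by case: bracket_biderivation.
have E (k : 'I_4) : [|| k == iq1, k == ip1, k == iq2 | k == ip2].
  by case: k => [[|[|[|[|//]]]] ?].
rewrite /omega !mxE.
by case/or4P: (E a) => /eqP->; case/or4P: (E b) => /eqP->;
  rewrite ?(b12, b34, b13, b14, b23, b24, brxx) //=
   1?skew ?(b12, b34, b13, b14, b23, b24) /=
   ?(subr0, sub0r, addr0, add0r, oppr0).
Qed.

(** The canonical relations say [J *m omega *m J^T = omega], which is the
wanted equation for the transposed Jacobian. *)
Lemma canonical_symplectic xi :
  canonical_coordinates bracket xi -> symplectic xi.
Proof.
move=> can; rewrite /symplectic; set J := jacobian xi; set w := omega F.
have JwJ : J *m w *m J^T = w.
  apply/matrixP=> a b; rewrite -(bracket_omega _ _ can) symplectic_form_entry.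
  have JE c d : J c d = pderiv d (xi c) by rewrite mxE.
  by rewrite !JE.
exact: (transpose_isometry (symplectic_form_sqr _) JwJ).
Qed.

(** Along the flow, [xi a] has derivative [dT (xi a) + {xi a, K(xi)} + {xi a,
c}]. The last term cancels the first by hypothesis, and the middle one is a
combination of the brackets of the coordinates. *)
Lemma hamiltonian_transport (dT : ratfun F -> ratfun F)
    (H K : {mpoly F[4]}) c xi :
  canonical_coordinates bracket xi ->
  eval_at xi K = tofrac H - c ->
  (forall a, dT (xi a) + bracket (xi a) c = 0) ->
  hamiltonian_direction (flow dT H) xi K.
Proof.
move=> can KE corr.
have sum4 (G : 'I_4 -> ratfun F) :
    \sum_b G b = G iq1 + G ip1 + G iq2 + G ip2.
  rewrite !big_ord_recl big_ord0 addr0 !addrA.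
  by congr (G _ + G _ + G _ + G _); apply: val_inj.
have flowE a : flow dT H (xi a) =
    \sum_b eval_at xi (mderiv b K) * bracket (xi a) (xi b).
  have -> : flow dT H (xi a) = dT (xi a) + bracket (xi a) (tofrac H).
    by rewrite /flow /bracket !pderiv_tofrac !addrA.
  have [_ dr _] := bracket_biderivation.
  have -> : tofrac H = eval_at xi K + c by rewrite KE subrK.
  rewrite (proj1 (dr _)) addrCA corr addr0 (derivation_eval_at _ _ (dr _)) //.
  by move=> k; rewrite (biderivation_skew bracket_biderivation) casimir_cst
    oppr0.
case: can => b12 b34 [b13 b14 b23 b24].
have skew f g := biderivation_skew bracket_biderivation f g.
have [_ _ brxx] := bracket_biderivation.
by split; rewrite flowE sum4 ?brxx
    ?(skew (xi ip1) (xi iq1), skew (xi iq2) (xi iq1), skew (xi ip2) (xi iq1),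
      skew (xi iq2) (xi ip1), skew (xi ip2) (xi ip1), skew (xi ip2) (xi iq2))
    ?(b12, b34, b13, b14, b23, b24)
    ?(oppr0, mulr0, add0r, addr0, mulr1, mulrN1).
Qed.

End PhaseSpaceCalculus.

(** * Inverses of the maps *)

Lemma tuple4E (T : Type) (f : 'I_4 -> T) a :
  tnth [tuple f iq1; f ip1; f iq2; f ip2] a = f a.
Proof. by case: a => [[|[|[|[|//]]]] ?]; congr (f _); exact: val_inj. Qed.

Section RtransAlgebra.
Variables (K : fieldType) (t s a0 a1 a2 a3 a4 a5 a6 : K).
Local Notation Rtr := (Rtrans t s a0 a1 a2 a3 a4 a5 a6).

Definition Rinverse (x y z w : K) (i : 'I_7) : 'I_4 -> K :=
  tnth (tnth
    [tuple
      [tuple t + y * (a0 - x * y); 1 / y; z; w];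
      [tuple s + y * (a1 - x * y); 1 / y; z; w];
      [tuple 1 / x; - (x * y + a2) * x; z; w];
      [tuple z + y * (a3 - x * y); 1 / y; z; w - 1 / y];
      [tuple x; y; 1 / z; - (z * w + a4) * z];
      [tuple x; y; 1 + w * (a5 - z * w); 1 / w];
      [tuple x; y; w * (a6 - z * w); 1 / w]] i).

(** The coordinate inverted by the map and by its inverse: both are defined
wherever it does not vanish. *)
Definition pivot (i : 'I_7) : 'I_4 :=
  tnth [tuple ip1; ip1; iq1; ip1; iq2; ip2; ip2] i.

Lemma RtransK q1 p1 q2 p2 i a :
  let xi := tnth [tuple q1; p1; q2; p2] in xi (pivot i) != 0 ->
  let eta := Rtr q1 p1 q2 p2 i in
  Rinverse (eta iq1) (eta ip1) (eta iq2) (eta ip2) i a = xi a.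
Proof.
(* The images stay folded until the outer map is unfolded: simplifying the
   composite in one go duplicates them and blows up. *)
move=> /=; set x := Rtr _ _ _ _ _ iq1; set y := Rtr _ _ _ _ _ ip1.
set z := Rtr _ _ _ _ _ iq2; set w := Rtr _ _ _ _ _ ip2.
move: @x @y @z @w.
case: i a => [[|[|[|[|[|[|[|//]]]]]]] ?] [[|[|[|[|//]]]] ?] x y z w;
  rewrite /pivot /tnth /= => n0; rewrite /Rinverse /tnth /=;
  rewrite /w /z /y /x /Rtrans /tnth /=; by field; rewrite ?n0 ?oner_neq0.
Qed.

Lemma RinverseK x y z w i a :
  let eta := tnth [tuple x; y; z; w] in eta (pivot i) != 0 ->
  let xi := Rinverse x y z w i in
  Rtr (xi iq1) (xi ip1) (xi iq2) (xi ip2) i a = eta a.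
Proof.
move=> /=; set q1 := Rinverse _ _ _ _ _ iq1; set p1 := Rinverse _ _ _ _ _ ip1.
set q2 := Rinverse _ _ _ _ _ iq2; set p2 := Rinverse _ _ _ _ _ ip2.
move: @q1 @p1 @q2 @p2.
case: i a => [[|[|[|[|[|[|[|//]]]]]]] ?] [[|[|[|[|//]]]] ?] q1 p1 q2 p2;
  rewrite /pivot /tnth /= => n0; rewrite /Rtrans /tnth /=;
  rewrite /p2 /q2 /p1 /q1 /Rinverse /tnth /=; by field; rewrite ?n0 ?oner_neq0.
Qed.

Lemma Rtrans_pivot q1 p1 q2 p2 i :
  Rtr q1 p1 q2 p2 i (pivot i) = 1 / tnth [tuple q1; p1; q2; p2] (pivot i).
Proof.
by case: i => [[|[|[|[|[|[|[|//]]]]]]] ?]; rewrite /pivot /Rtrans /tnth /=.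
Qed.

Lemma Rinverse_pivot x y z w i :
  Rinverse x y z w i (pivot i) = 1 / tnth [tuple x; y; z; w] (pivot i).
Proof.
by case: i => [[|[|[|[|[|[|[|//]]]]]]] ?]; rewrite /pivot /Rinverse /tnth /=.
Qed.

(** Exchanging [t] with [s] and [a0] with [a1] exchanges [R_0] and [R_1]. *)
Lemma Rtrans_swap q1 p1 q2 p2 i a :
  Rtrans s t a1 a0 a2 a3 a4 a5 a6 q1 p1 q2 p2
    (tperm ord0 (@Ordinal 7 1 isT) i) a = Rtr q1 p1 q2 p2 i a.
Proof.
case: tpermP => [->|->|]; rewrite /Rtrans /tnth //.
by case: i => [[|[|[|[|[|[|[|//]]]]]]] ?] i0 i1 //;
  [case: i0; exact: val_inj | case: i1; exact: val_inj].
Qed.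
End RtransAlgebra.

Section Parametricity.
Variables (K L : fieldType) (rel : K -> L -> Prop).

(** Relations such as [comp_eq _ xi _] that behave like a partially defined
field morphism; inversion requires the value to be nonzero. *)
Definition field_relation : Prop :=
  [/\ rel 1 1, forall f f', rel f f' -> rel (- f) (- f'),
      forall f f' g g', rel f f' -> rel g g' -> rel (f + g) (f' + g'),
      forall f f' g g', rel f f' -> rel g g' -> rel (f * g) (f' * g') &
      forall f f', f' != 0 -> rel f f' -> rel f^-1 f'^-1].

Hypothesis relP : field_relation.
Variables (t s a0 a1 a2 a3 a4 a5 a6 q1 p1 q2 p2 : K).
Variables (t' s' a0' a1' a2' a3' a4' a5' a6' q1' p1' q2' p2' : L).
Hypotheses (tP : rel t t') (sP : rel s s') (a0P : rel a0 a0') (a1P : rel a1 a1')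
  (a2P : rel a2 a2') (a3P : rel a3 a3') (a4P : rel a4 a4') (a5P : rel a5 a5')
  (a6P : rel a6 a6').
Hypotheses (q1P : rel q1 q1') (p1P : rel p1 p1') (q2P : rel q2 q2')
  (p2P : rel p2 p2').

Variable i : 'I_7.
Hypothesis pivot_neq0 : tnth [tuple q1'; p1'; q2'; p2'] (pivot i) != 0.

(** The coordinates of [R_i] are built from their arguments by field
operations, the only division being by the pivot. *)
Lemma Rtrans_relation a :
  rel (Rtrans t s a0 a1 a2 a3 a4 a5 a6 q1 p1 q2 p2 i a)
    (Rtrans t' s' a0' a1' a2' a3' a4' a5' a6' q1' p1' q2' p2' i a).
Proof.
case: relP => r1 rN rD rM rV; move: pivot_neq0.
by case: i a => [[|[|[|[|[|[|[|//]]]]]]] ?] [[|[|[|[|//]]]] ?];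
  rewrite /pivot /Rtrans /tnth /= ?div1r => n0;
  repeat first [assumption | apply rD | apply rM | apply rN | apply rV].
Qed.

Lemma Rinverse_relation a :
  rel (Rinverse t s a0 a1 a2 a3 a4 a5 a6 q1 p1 q2 p2 i a)
    (Rinverse t' s' a0' a1' a2' a3' a4' a5' a6' q1' p1' q2' p2' i a).
Proof.
case: relP => r1 rN rD rM rV; move: pivot_neq0.
by case: i a => [[|[|[|[|[|[|[|//]]]]]]] ?] [[|[|[|[|//]]]] ?];
  rewrite /pivot /Rinverse /tnth /= ?div1r => n0;
  repeat first [assumption | apply rD | apply rM | apply rN | apply rV].
Qed.
End Parametricity.

(** * Birationality *)

Section Birational.
Variable F : fieldType.
Implicit Types (xi eta : 'I_4 -> ratfun F) (f g : ratfun F).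

Lemma comp_eq_tofrac xi (P : {mpoly F[4]}) :
  comp_eq (tofrac P) xi (eval_at xi P).
Proof.
exists P, 1; rewrite tofrac1 (rmorph1 (eval_at xi)) !divr1.
by split=> //; exact: oner_neq0.
Qed.

Lemma comp_eq_cst xi (c : F) : comp_eq (cst c) xi (cst c).
Proof. by rewrite -{2}(eval_atC xi c); exact: comp_eq_tofrac. Qed.

Lemma comp_eq1 xi : comp_eq 1 xi 1.
Proof. by rewrite -(rmorph1 (@cst F)); exact: comp_eq_cst. Qed.

Lemma comp_eq_var xi a : comp_eq (phase_var F a) xi (xi a).
Proof. by rewrite -(eval_atX xi a); exact: comp_eq_tofrac. Qed.

Lemma eval_at_neq0 xi (P : {mpoly F[4]}) : eval_at xi P != 0 -> tofrac P != 0.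
Proof.
by rewrite tofrac_eq0; apply: contra_neq => ->; exact: (rmorph0 (eval_at xi)).
Qed.

Lemma comp_eqM f g f' g' xi : comp_eq f xi f' -> comp_eq g xi g' ->
  comp_eq (f * g) xi (f' * g').
Proof.
move=> [n [d [-> d0 ->]]] [m [e [-> e0 ->]]]; exists (n * m), (d * e).
split; [by rewrite !tofracM -mulf_div | | by rewrite !eval_atM -mulf_div].
by rewrite eval_atM; exact: mulf_neq0 d0 e0.
Qed.

Lemma comp_eqD f g f' g' xi : comp_eq f xi f' -> comp_eq g xi g' ->
  comp_eq (f + g) xi (f' + g').
Proof.
move=> [n [d [-> d0 ->]]] [m [e [-> e0 ->]]]; exists (n * e + m * d), (d * e).
split.
- rewrite (addf_div (tofrac n) (tofrac m) (eval_at_neq0 d0) (eval_at_neq0 e0)).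
  by rewrite tofracD !tofracM.
- by rewrite eval_atM; exact: mulf_neq0 d0 e0.
- by rewrite eval_atD !eval_atM; exact: addf_div d0 e0.
Qed.

Lemma comp_eqN f f' xi : comp_eq f xi f' -> comp_eq (- f) xi (- f').
Proof.
move=> [n [d [-> d0 ->]]]; exists (- n), d.
by rewrite tofracN (rmorphN (eval_at xi)) !mulNr.
Qed.

Lemma comp_eqV f f' xi : f' != 0 -> comp_eq f xi f' -> comp_eq f^-1 xi f'^-1.
Proof.
move=> f'0 [n [d [-> d0 f'E]]]; exists d, n; split.
- exact: (invf_div (tofrac n) (tofrac d)).
- by apply: contra_neq f'0 => n0; rewrite f'E n0 mul0r.
- by rewrite f'E; exact: (invf_div (eval_at xi n) (eval_at xi d)).
Qed.

Lemma comp_eq_field_relation xi : field_relation (fun f g => comp_eq f xi g).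
Proof.
split; [exact: comp_eq1 | move=> *; exact: comp_eqN | move=> *; exact: comp_eqD
  | move=> *; exact: comp_eqM | move=> *; exact: comp_eqV].
Qed.

Variables t s a0 a1 a2 a3 a4 a5 a6 : F.
Local Notation X := (phase_var F).
Local Notation Rtr := (Rtrans (cst t) (cst s) (cst a0) (cst a1) (cst a2)
  (cst a3) (cst a4) (cst a5) (cst a6)).
Local Notation Rinv := (Rinverse (cst t) (cst s) (cst a0) (cst a1) (cst a2)
  (cst a3) (cst a4) (cst a5) (cst a6)).

Lemma comp_eq_Rtrans eta i a : eta (pivot i) != 0 ->
  comp_eq (Rtr (X iq1) (X ip1) (X iq2) (X ip2) i a) eta
    (Rtr (eta iq1) (eta ip1) (eta iq2) (eta ip2) i a).
Proof.
rewrite -{1}(tuple4E eta) => n0.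
exact: (Rtrans_relation (comp_eq_field_relation eta)
  (comp_eq_cst _ t) (comp_eq_cst _ s) (comp_eq_cst _ a0) (comp_eq_cst _ a1)
  (comp_eq_cst _ a2) (comp_eq_cst _ a3) (comp_eq_cst _ a4) (comp_eq_cst _ a5)
  (comp_eq_cst _ a6) (comp_eq_var _ _) (comp_eq_var _ _) (comp_eq_var _ _)
  (comp_eq_var _ _) n0).
Qed.

Lemma comp_eq_Rinverse xi i a : xi (pivot i) != 0 ->
  comp_eq (Rinv (X iq1) (X ip1) (X iq2) (X ip2) i a) xi
    (Rinv (xi iq1) (xi ip1) (xi iq2) (xi ip2) i a).
Proof.
rewrite -{1}(tuple4E xi) => n0.
exact: (Rinverse_relation (comp_eq_field_relation xi)
  (comp_eq_cst _ t) (comp_eq_cst _ s) (comp_eq_cst _ a0) (comp_eq_cst _ a1)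
  (comp_eq_cst _ a2) (comp_eq_cst _ a3) (comp_eq_cst _ a4) (comp_eq_cst _ a5)
  (comp_eq_cst _ a6) (comp_eq_var _ _) (comp_eq_var _ _) (comp_eq_var _ _)
  (comp_eq_var _ _) n0).
Qed.

Lemma Rtrans_birational i :
  birational (Rtr (X iq1) (X ip1) (X iq2) (X ip2) i).
Proof.
have Xn0 : tnth [tuple X iq1; X ip1; X iq2; X ip2] (pivot i) != 0.
  by rewrite tuple4E phase_var_neq0.
exists (Rinv (X iq1) (X ip1) (X iq2) (X ip2) i); split=> a.
- have := @comp_eq_Rinverse (Rtr (X iq1) (X ip1) (X iq2) (X ip2) i) i a.
  rewrite RtransK // Rtrans_pivot div1r invr_eq0 !tuple4E; apply.
  exact: phase_var_neq0.
- have := @comp_eq_Rtrans (Rinv (X iq1) (X ip1) (X iq2) (X ip2) i) i a.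
  rewrite RinverseK // Rinverse_pivot div1r invr_eq0 !tuple4E; apply.
  exact: phase_var_neq0.
Qed.
End Birational.

(** * Functions polynomial in the new coordinates *)

(** The second Hamiltonian is the first one with [t], [s] and [a0], [a1]
exchanged; its chart number [i] is chart number [tperm 0 1 i] of the first. *)
Lemma Hformula_swap_chart (K : fieldType) (S : subringClosed K)
    (t s a0 a1 a2 a3 a4 a5 a6 q1 p1 q2 p2 : K) (i : 'I_7) :
  a0 + a1 + 2 * a2 + 2 * a3 + 2 * a4 + a5 + a6 = 1 ->
  s * (s - 1) * (s - t) != 0 ->
  t \in S -> s \in S -> (s * (s - 1) * (s - t))^-1 \in S ->
  a0 \in S -> a1 \in S -> a2 \in S -> a3 \in S -> a4 \in S -> a5 \in S ->
  a6 \in S -> q1 != 0 -> p1 != 0 -> q2 != 0 -> p2 != 0 ->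
  (forall a, Rtrans t s a0 a1 a2 a3 a4 a5 a6 q1 p1 q2 p2 i a \in S) ->
  Hformula s t a1 a0 a2 a3 a4 a5 a6 q1 p1 q2 p2
    - (if nat_of_ord i == 1%N then p1 else 0) \in S.
Proof.
rewrite (addrC a0) => sum1 dn0 tS sS dS a0S a1S a2S a3S a4S a5S a6S.
move=> q1n p1n q2n p2n RS.
pose j := tperm ord0 (@Ordinal 7 1 isT) i.
have -> : (nat_of_ord i == 1%N) = (nat_of_ord j == 0%N).
  rewrite /j; case: tpermP => [->|->|] //.
  by case: i {RS j} => [[|[|k]] ?] i0 i1 //;
    [case: i0 | case: i1]; exact: val_inj.
by apply: Hformula_chart => // a; rewrite Rtrans_swap.
Qed.

(** The functions polynomial in the coordinates [xi] form a subring containing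
the constants, so that the memberships proved above yield the polynomials [K].
*)
Section PolynomialsInChart.
Variables (F : fieldType) (xi : 'I_4 -> ratfun F).

Definition polys_in : {pred ratfun F} :=
  fun f => `[< exists P : {mpoly F[4]}, eval_at xi P = f >].

Lemma polys_inP f :
  reflect (exists P : {mpoly F[4]}, eval_at xi P = f) (f \in polys_in).
Proof. exact: asboolP. Qed.

Lemma polys_in_eval P : eval_at xi P \in polys_in.
Proof. by apply/polys_inP; exists P. Qed.

Fact polys_in_subring : subring_closed polys_in.
Proof.
split=> [|f g /polys_inP[P <-] /polys_inP[Q <-]|
  f g /polys_inP[P <-] /polys_inP[Q <-]].
- by rewrite -(rmorph1 (eval_at xi)) polys_in_eval.
- by rewrite -(rmorphB (eval_at xi)) polys_in_eval.
- by rewrite -eval_atM polys_in_eval.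
Qed.

HB.instance Definition _ := GRing.isSubringClosed.Build (ratfun F) polys_in
  polys_in_subring.

Lemma polys_in_cst c : cst c \in polys_in.
Proof. by rewrite -(eval_atC xi) polys_in_eval. Qed.

Lemma polys_in_coordinate a : xi a \in polys_in.
Proof. by rewrite -(eval_atX xi) polys_in_eval. Qed.
End PolynomialsInChart.

(** * Derivatives with respect to the times *)

Section Times.
Variable R : realType.

Lemma coefficient_derivation k :
  derivation (frac_deriv (mderiv k) : Cts R -> Cts R).
Proof. exact/frac_deriv_derivation/mderiv_derivation. Qed.

Lemma time_deriv_derivation k : derivation (@time_deriv R k).
Proof.
exact/frac_deriv_derivation/map_mpoly_derivation/coefficient_derivation.
Qed.

Lemma time_deriv_cst k (c : Cts R) :
  time_deriv k (cst c) = cst (frac_deriv (mderiv k) c).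
Proof.
rewrite /time_deriv frac_deriv_tofrac; last first.
  exact/map_mpoly_derivation/coefficient_derivation.
by rewrite map_derivationC //; exact: coefficient_derivation.
Qed.

Lemma time_deriv_phase_var k a : time_deriv k (phase_var (Cts R) a) = 0.
Proof.
rewrite /time_deriv frac_deriv_tofrac; last first.
  exact/map_mpoly_derivation/coefficient_derivation.
by rewrite map_derivationX ?tofrac0 //; exact: coefficient_derivation.
Qed.

Lemma time_deriv_param k (c : complex R) : time_deriv k (param c) = 0.
Proof.
rewrite time_deriv_cst frac_deriv_tofrac; last exact: mderiv_derivation.
by rewrite mderivC tofrac0 (rmorph0 (@cst _)).
Qed.

Lemma time_deriv_time k l : time_deriv k (time R l) = (k == l)%:R.
Proof.
rewrite time_deriv_cst frac_deriv_tofrac; last exact: mderiv_derivation.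
by rewrite mderiv_var rmorph_nat (rmorph_nat (@cst _)).
Qed.

Lemma time_deriv_self k : time_deriv k (time R k) = 1.
Proof. by rewrite time_deriv_time eqxx. Qed.

Lemma time_deriv_other k l : k != l -> time_deriv k (time R l) = 0.
Proof. by rewrite time_deriv_time => /negPf->. Qed.

Local Notation T j := (tofrac 'X_j : Cts R).

(** Each factor has derivative 1 in the [k]-th time, hence is not zero. *)
Lemma times_generic k l : k != l ->
  T k * (T k - 1) * (T k - T l) != 0.
Proof.
move=> kl; have dD := coefficient_derivation k.
have DT j : frac_deriv (mderiv k) (T j) = (k == j)%:R.
  by rewrite frac_deriv_tofrac ?mderiv_var ?rmorph_nat //; exact: mderiv_derivation.
have D1 := DT k; rewrite eqxx in D1.
have D0 := DT l; rewrite (negPf kl) in D0.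
have n1 := derivation_neq0 dD D1.
have n2 := derivationB_neq0 dD D1 (derivation1 dD).
have n3 := derivationB_neq0 dD D1 D0.
exact: mulf_neq0 (mulf_neq0 n1 n2) n3.
Qed.
End Times.

(** * The transformed systems over an arbitrary field of constants *)

Section ChartTheorem.
Variables (F : fieldType) (t s a0 a1 a2 a3 a4 a5 a6 : F).
Hypothesis sum1 : a0 + a1 + 2 * a2 + 2 * a3 + 2 * a4 + a5 + a6 = 1.
Hypothesis dt_neq0 : t * (t - 1) * (t - s) != 0.
Hypothesis ds_neq0 : s * (s - 1) * (s - t) != 0.

Local Notation X := (phase_var F).
Local Notation formula1 := (Hformula (cst t) (cst s) (cst a0) (cst a1) (cst a2)
  (cst a3) (cst a4) (cst a5) (cst a6) (X iq1) (X ip1) (X iq2) (X ip2)).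
Local Notation formula2 := (Hformula (cst s) (cst t) (cst a1) (cst a0) (cst a2)
  (cst a3) (cst a4) (cst a5) (cst a6) (X iq1) (X ip1) (X iq2) (X ip2)).
Local Notation Rtr := (Rtrans (cst t) (cst s) (cst a0) (cst a1) (cst a2)
  (cst a3) (cst a4) (cst a5) (cst a6) (X iq1) (X ip1) (X iq2) (X ip2)).

Lemma cst_denominator (u v : F) :
  cst u * (cst u - 1) * (cst u - cst v) = cst (u * (u - 1) * (u - v)).
Proof.
by rewrite !(rmorphM (@cst F)) !(rmorphB (@cst F)) (rmorph1 (@cst F)).
Qed.

Lemma cst_sum1 : cst a0 + cst a1 + 2 * cst a2 + 2 * cst a3 + 2 * cst a4 + cst a5
  + cst a6 = 1.
Proof.
rewrite -[RHS](rmorph1 (@cst F)) -[in RHS]sum1.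
by rewrite !(rmorphD (@cst F)) !(rmorphM (@cst F)) !(rmorph_nat (@cst F)).
Qed.

Lemma cst_denominator_neq0 (u v : F) : u * (u - 1) * (u - v) != 0 ->
  cst u * (cst u - 1) * (cst u - cst v) != 0.
Proof. by move=> n0; rewrite cst_denominator (fmorph_eq0 (@cst F)). Qed.

Lemma cst_denominator_polys_in xi (u v : F) :
  (cst u * (cst u - 1) * (cst u - cst v))^-1 \in polys_in xi.
Proof. by rewrite cst_denominator -(fmorphV (@cst F)) polys_in_cst. Qed.

(** In the original coordinates polynomiality is immediate, the denominator
being a constant. *)
Lemma Hformula_mpoly : exists H1 H2 : {mpoly F[4]},
  tofrac H1 = formula1 /\ tofrac H2 = formula2.
Proof.
have cS c := polys_in_cst X c; have XS a := polys_in_coordinate X a.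
have sum1' := cst_sum1.
have /polys_inP[H1 H1E] : formula1 \in polys_in X.
  exact: (Hformula_polynomial sum1' (cS t) (cS s)
    (cst_denominator_polys_in X t s) (cS a1) (cS a2) (cS a3) (cS a4)
    (cS a5) (cS a6) (XS iq1) (XS ip1) (XS iq2) (XS ip2)).
rewrite (addrC (cst a0)) in sum1'.
have /polys_inP[H2 H2E] : formula2 \in polys_in X.
  exact: (Hformula_polynomial sum1' (cS s) (cS t)
    (cst_denominator_polys_in X s t) (cS a0) (cS a2) (cS a3) (cS a4)
    (cS a5) (cS a6) (XS iq1) (XS ip1) (XS iq2) (XS ip2)).
by exists H1, H2; rewrite -H1E -H2E !eval_at_phase_var.
Qed.

Variables (dT dS : ratfun F -> ratfun F) (H1 H2 : {mpoly F[4]}).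
Hypotheses (derT : derivation dT) (derS : derivation dS).
Hypotheses (dTX : forall a, dT (X a) = 0) (dSX : forall a, dS (X a) = 0).
Hypotheses (dTt : dT (cst t) = 1) (dTs : dT (cst s) = 0)
  (dSt : dS (cst t) = 0) (dSs : dS (cst s) = 1).
Hypothesis dTa :
  forall c, c \in [:: a0; a1; a2; a3; a4; a5; a6] -> dT (cst c) = 0.
Hypothesis dSa :
  forall c, c \in [:: a0; a1; a2; a3; a4; a5; a6] -> dS (cst c) = 0.
Hypotheses (H1E : tofrac H1 = formula1) (H2E : tofrac H2 = formula2).

Lemma phase_var_system : hamiltonian_system (flow dT H1) (flow dS H2) X H1 H2.
Proof.
have [_ dr _] := bracket_biderivation F.
by split; apply: (hamiltonian_transport (c := 0) (phase_var_canonical F));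
  rewrite ?subr0 ?eval_at_phase_var // => a;
  rewrite (derivation0 (dr _)) addr0 ?dTX ?dSX.
Qed.

Lemma Rtrans_bracket_canonical i : canonical_coordinates (@bracket F) (Rtr i).
Proof.
have C c := @casimir_cst F c; have X0 a := @phase_var_neq0 F a.
exact: (Rtrans_canonical (bracket_biderivation F) (C t) (C s) (C a0) (C a1)
  (C a2) (C a3) (C a4) (C a5) (C a6) (X0 iq1) (X0 ip1) (X0 iq2) (X0 ip2)
  (phase_var_canonical F) i).
Qed.

(** The polynomial [K1] represents [H1] up to [dT (cst t) * p1] for [R_0] and
up to [dT (cst s) * p1] for [R_1], that is, [p1] and 0; symmetrically for
[K2]. *)
Lemma Rtrans_hamiltonian i : exists K1 K2 : {mpoly F[4]},
  [/\ eval_at (Rtr i) K1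
        = tofrac H1 - (if nat_of_ord i == 0%N then X ip1 else 0),
      eval_at (Rtr i) K2
        = tofrac H2 - (if nat_of_ord i == 1%N then X ip1 else 0) &
      hamiltonian_system (flow dT H1) (flow dS H2) (Rtr i) K1 K2].
Proof.
have cS c := polys_in_cst (Rtr i) c.
have X0 a := @phase_var_neq0 F a.
have C c := @casimir_cst F c.
have RS a := polys_in_coordinate (Rtr i) a.
have /polys_inP[K1 K1E] := Hformula_chart cst_sum1 (cst_denominator_neq0 dt_neq0)
  (cS t) (cS s) (cst_denominator_polys_in _ t s) (cS a0) (cS a1) (cS a2) (cS a3)
  (cS a4) (cS a5) (cS a6) (X0 iq1) (X0 ip1) (X0 iq2) (X0 ip2) RS.
have /polys_inP[K2 K2E] := Hformula_swap_chart cst_sum1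
  (cst_denominator_neq0 ds_neq0) (cS t) (cS s) (cst_denominator_polys_in _ s t)
  (cS a0) (cS a1) (cS a2) (cS a3) (cS a4) (cS a5) (cS a6) (X0 iq1) (X0 ip1)
  (X0 iq2) (X0 ip2) RS.
have corr D (derD : derivation D) (DX : forall a, D (X a) = 0)
    (Da : forall c, c \in [:: a0; a1; a2; a3; a4; a5; a6] -> D (cst c) = 0)
    dt ds (Dt : D (cst t) = cst dt) (Ds : D (cst s) = cst ds) a :
    D (Rtr i a) + bracket (Rtr i a)
      (if nat_of_ord i == 0%N then cst dt * X ip1
       else if nat_of_ord i == 1%N then cst ds * X ip1 else 0) = 0.
  have Cdt : casimir (@bracket F) (D (cst t)) by rewrite Dt; exact: C.
  have Cds : casimir (@bracket F) (D (cst s)) by rewrite Ds; exact: C.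
  rewrite -Dt -Ds.
  by apply: (Rtrans_time_correction (bracket_biderivation F) (C t) (C s) (C a0)
    (C a1) (C a2) (C a3) (C a4) (C a5) (C a6) (X0 iq1) (X0 ip1) (X0 iq2)
    (X0 ip2) (phase_var_canonical F) derD) => //;
    first [exact: DX | apply: Da; rewrite !inE eqxx ?orbT].
have c0 : cst (0 : F) = 0 := rmorph0 (@cst F).
have c1 : cst (1 : F) = 1 := rmorph1 (@cst F).
exists K1, K2; rewrite H1E H2E; split=> //; split.
- apply: hamiltonian_transport (Rtrans_bracket_canonical i) _ _.
    by rewrite K1E H1E.
  move=> a; have := corr dT derT dTX dTa 1 0; rewrite c0 c1 mul1r mul0r if_same.
  by apply.
- apply: hamiltonian_transport (Rtrans_bracket_canonical i) _ _.
    by rewrite K2E H2E.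
  move=> a; have := corr dS derS dSX dSa 0 1; rewrite c0 c1 mul1r mul0r => corrS.
  by rewrite -[RHS](corrS dSt dSs a); case: (nat_of_ord i) => [|[|]].
Qed.
End ChartTheorem.

Lemma param_sum1 (R : realType) (a0 a1 a2 a3 a4 a5 a6 : complex R) :
  a0 + a1 + 2 * a2 + 2 * a3 + 2 * a4 + a5 + a6 = 1 ->
  let C c : Cts R := tofrac (mpolyC 2 c) in
  C a0 + C a1 + 2 * C a2 + 2 * C a3 + 2 * C a4 + C a5 + C a6 = 1.
Proof.
move=> sum1 C.
transitivity (C (a0 + a1 + 2 * a2 + 2 * a3 + 2 * a4 + a5 + a6)).
  have CD x y : C (x + y) = C x + C y by rewrite /C mpolyCD tofracD.
  have C2 x : C (2 * x) = 2 * C x.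
    by rewrite /C mpolyCM tofracM mpolyC_nat rmorph_nat.
  by rewrite !CD !C2.
by rewrite /C sum1 mpolyC1 tofrac1.
Qed.

Theorem mainTheorem1 (R : realType)
    (a0 a1 a2 a3 a4 a5 a6 : complex R) :
  a0 + a1 + 2 * a2 + 2 * a3 + 2 * a4 + a5 + a6 = 1 ->
  let t := time R time_t in
  let s := time R time_s in
  let q1 := phase_var (Cts R) iq1 in
  let p1 := phase_var (Cts R) ip1 in
  let q2 := phase_var (Cts R) iq2 in
  let p2 := phase_var (Cts R) ip2 in
  let A0 := param a0 in let A1 := param a1 in let A2 := param a2 in
  let A3 := param a3 in let A4 := param a4 in let A5 := param a5 in
  let A6 := param a6 in
  exists H1 H2 : {mpoly (Cts R)[4]},
    let Dt := flow (time_deriv time_t) H1 in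
    let Ds := flow (time_deriv time_s) H2 in
    [/\ tofrac H1 = Hformula t s A0 A1 A2 A3 A4 A5 A6 q1 p1 q2 p2,
        tofrac H2 = Hformula s t A1 A0 A2 A3 A4 A5 A6 q1 p1 q2 p2,
        hamiltonian_system Dt Ds (phase_var (Cts R)) H1 H2 &
        forall i : 'I_7,
          let xi := Rtrans t s A0 A1 A2 A3 A4 A5 A6 q1 p1 q2 p2 i in
          [/\ birational xi,
              symplectic xi &
              exists K1 K2 : {mpoly (Cts R)[4]},
                [/\ eval_at xi K1
                      = tofrac H1 - (if nat_of_ord i == 0%N then p1 else 0),
                    eval_at xi K2
                      = tofrac H2 - (if nat_of_ord i == 1%N then p1 else 0) &
                    hamiltonian_system Dt Ds xi K1 K2]]].
Proof.
move=> sum1 t s q1 p1 q2 p2 A0 A1 A2 A3 A4 A5 A6.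
pose C (c : complex R) : Cts R := tofrac (mpolyC 2 c).
have SUM : C a0 + C a1 + 2 * C a2 + 2 * C a3 + 2 * C a4 + C a5 + C a6 = 1.
  exact: param_sum1.
have dt := times_generic R (isT : time_t != time_s).
have ds := times_generic R (isT : time_s != time_t).
have [H1 [H2 [H1E H2E]]] := Hformula_mpoly (tofrac 'X_time_t)
  (tofrac 'X_time_s) SUM.
have dX k a := @time_deriv_phase_var R k a.
have dtt : time_deriv time_t t = 1 := time_deriv_self R time_t.
have dss : time_deriv time_s s = 1 := time_deriv_self R time_s.
have dts : time_deriv time_t s = 0 :=
  time_deriv_other R (isT : time_t != time_s).
have dst : time_deriv time_s t = 0 :=
  time_deriv_other R (isT : time_s != time_t).
have dA k c : c \in [:: C a0; C a1; C a2; C a3; C a4; C a5; C a6] ->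
    time_deriv k (cst c) = 0.
  by rewrite !inE; do 6![case/predU1P=> [->|]; first exact: time_deriv_param];
    move=> /eqP->; exact: time_deriv_param.
exists H1, H2; split; [exact: H1E | exact: H2E | | move=> i; split].
- exact: (phase_var_system H1 H2 (dX _) (dX _)).
- exact: Rtrans_birational.
- exact/canonical_symplectic/Rtrans_bracket_canonical.
- exact: (Rtrans_hamiltonian SUM dt ds (@time_deriv_derivation R time_t)
    (@time_deriv_derivation R time_s) (dX _) (dX _) dtt dts dst dss (dA _)
    (dA _) H1E H2E i).
Qed.
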